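(* Let $G$ be any $\Delta$-regular graph with order $n$ and size $m$. Then its alliance polynomial $A(G;x)$ satisfies the following properties: (i) $A_{-\Delta+2i}(G)$ is the number of connected induced subgraphs of $G$ with minimum degree $i$, for $0\le i\le\Delta$. (ii) $\operatorname{Deg}_{\min}(A(G;x)) = n-\Delta$ and $A_{-\Delta}(G)=n$. (iii) $\operatorname{Deg}(A(G;x)) = n+\Delta$. Furthermore, $$n=\frac{\operatorname{Deg}_{\min}(A(G;x))+\operatorname{Deg}(A(G;x))}{2}$$ and $$m = A_{-\Delta}(G)\,\frac{\operatorname{Deg}(A(G;x))-\operatorname{Deg}_{\min}(A(G;x))}{4} = \frac{\operatorname{Deg}(A(G;x))^2-\operatorname{Deg}_{\min}(A(G;x))^2}{8}.$$ (iv) $1\le A_{\Delta}(G)\le n/(\Delta+1)$. Furthermore, $G$ is connected if and only if $A_{\Delta}(G)=1$. (v) If $\Delta>0$, then $A_{-\Delta+2}(G)\ge m$ and $A_{\Delta-2}(G)\ge n+n_0$, where $n_0$ is the number of cut vertices of $G$; in particular, $A_{\Delta-2}(G)\ge n$. (vi) $A(G;x)$ is either an even or an odd function of $x$. Furthermore, $A(G;x)$ is an even function of $x$ if and only if $n+\Delta$ is even. (vii) The unique real zero of $A(G;x)$ is $x=0$, and its multiplicity is $n-\Delta$.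
   Context: Graphs are finite, simple, nonempty, and not necessarily connected; the order is the number of vertices and the size is the number of edges. For a graph $G=(V,E)$ with order $n$ and maximum degree $\Delta$, and $X\subseteq V$, $\delta_X(v)$ is the number of neighbours of $v$ in $X$, $\overline{X}=V\setminus X$, and $\langle X\rangle$ is the induced subgraph. $G$ is $\Delta$-regular if all its vertices have degree $\Delta$. For a nonempty $S\subseteq V$ with $\langle S\rangle$ connected, and an integer $k\in[-\Delta,\Delta]$, $S$ is a defensive $k$-alliance if $\delta_S(v)\ge\delta_{\overline S}(v)+k$ for every $v\in S$; the exact index of alliance of $S$ is $k_S=\max\{k\in[-\Delta,\Delta]\cap\mathbb Z: S\text{ is a defensive }k\text{-alliance}\}=\min_{v\in S}\{\delta_S(v)-\delta_{\overline S}(v)\}$, and $S$ is called an exact defensive $k_S$-alliance. $A_k(G)$ denotes the number of exact defensive $k$-alliances in $G$ (subsets $S\subseteq V$), and the alliance polynomial of $G$ is $A(G;x)=\sum_{k=-\Delta}^{\Delta}A_k(G)\,x^{n+k}$. Connected induced subgraphs are counted by their (nonempty) vertex sets. For a polynomial $p$, $\operatorname{Deg}(p)$ is its degree and $\operatorname{Deg}_{\min}(p)$ is the minimum exponent of its terms with non-zero coefficient. A cut vertex is a vertex $v$ such that the graph obtained by removing $v$ and its incident edges has more connected components than $G$. *)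

(* Defs.v *)
From HB Require Import structures.
From mathcomp Require Import all_boot all_order all_algebra.
From mathcomp Require Import reals.

Set Implicit Arguments.
Unset Strict Implicit.
Unset Printing Implicit Defensive.

Import Order.TTheory GRing.Theory Num.Theory.

Local Open Scope ring_scope.

Record graph := Graph {
  vertex :> finType;
  adj : rel vertex;
  adj_sym : symmetric adj;
  adj_irr : irreflexive adj;
  vertex_gt0 : (0 < #|vertex|)%N
}.

Section GraphDefs.
Variable G : graph.
Implicit Types (v : G) (S X : {set G}) (k : int).

Definition graph_order : nat := #|G|.

Definition edges : {set {set G}} :=
  [set [set e.1; e.2] | e : G * G & adj e.1 e.2].

Definition graph_size : nat := #|edges|.

(* The number of neighbours of v in X, for v in X or not. *)
Definition deg_in X v : nat := #|[set u in X | adj v u]|.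

Definition degree v : nat := deg_in [set: G] v.

Definition max_degree : nat := \max_(v : G) degree v.

Definition is_regular (d : nat) : Prop := forall v, degree v = d.

(* The induced subgraph on X is represented by this relation, together with X
   as its vertex set: vertices outside X are isolated. *)
Definition induced X : rel G := [rel x y | [&& x \in X, y \in X & adj x y]].

Definition induced_connected X : bool :=
  (X != set0) && [forall x in X, forall y in X, connect (induced X) x y].

Definition connected_graph : bool := induced_connected [set: G].

Definition num_components X : nat := n_comp (induced X) X.

Definition cut_vertex v : bool :=
  (num_components [set: G] < num_components (~: [set v]))%N.

(* The default value of the minimum exceeds every degree; it is only reached
   when S is empty. *)
Definition induced_min_degree S : nat :=
  \big[minn/graph_order]_(v in S) deg_in S v.

Definition defensive_alliance k S : bool :=
  [&& - max_degree%:Z <= k <= max_degree%:Z, induced_connected S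
    & [forall v in S, (deg_in (~: S) v)%:Z + k <= (deg_in S v)%:Z]].

(* The integers of [- max_degree, max_degree], in increasing order. *)
Definition alliance_range : seq int :=
  [seq j%:Z - max_degree%:Z | j <- iota 0 (2 * max_degree).+1].

(* The default value - max_degree is harmless: every nonempty S inducing a
   connected subgraph is a defensive (- max_degree)-alliance. *)
Definition exact_index S : int :=
  \big[Num.max/ - max_degree%:Z]_(k <- alliance_range | defensive_alliance k S)
     k.

Definition exact_alliance k S : bool :=
  induced_connected S && (exact_index S == k).

Definition num_exact_alliances k : nat := #|[set S | exact_alliance k S]|.

(* On the range of summation, graph_order + k is positive because
   max_degree < graph_order, so the absolute value is only a cast to nat. *)
Definition alliance_poly (R : nzRingType) : {poly R} :=
  \sum_(k <- alliance_range)
     (num_exact_alliances k)%:R *: 'X^(absz (graph_order%:Z + k)).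

End GraphDefs.

(* For nonzero polynomials only; both are 0 on the zero polynomial. *)
Definition Deg (R : nzRingType) (p : {poly R}) : nat := (size p).-1.

Definition Deg_min (R : nzRingType) (p : {poly R}) : nat :=
  \big[minn/size p]_(i < size p | p`_i != 0) i.

Definition even_function (R : nzRingType) (f : R -> R) : Prop :=
  forall x, f (- x) = f x.

Definition odd_function (R : nzRingType) (f : R -> R) : Prop :=
  forall x, f (- x) = - f x.

(* Main.v *)
(* In a Delta-regular graph the exact index of a connected S is 2 d(S) - Delta,
   where d(S) is the minimum degree of the subgraph induced on S.  Hence
   A(G;x) = x^(n - Delta) q(x^2) with q = \sum_S x^d(S), which has nonnegative
   coefficients and positive constant term n: this gives the degrees, the parity
   and the zeros.  The sets with d(S) = 0, d(S) = Delta are the singletons and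
   the components of G.  For d(S) = Delta - 1, every component of G - v that
   meets the neighbourhood of v qualifies; there is at least one for each v, at
   least two if v is a cut vertex, and v is recovered as the only outside vertex
   adjacent to S. *)

Require Import Defs.
From HB Require Import structures.
From mathcomp Require Import all_boot all_order all_algebra.
From mathcomp Require Import reals.
From mathcomp Require Import zify ring.

Set Implicit Arguments.
Unset Strict Implicit.
Unset Printing Implicit Defensive.

Import Order.TTheory GRing.Theory Num.Theory.

Local Open Scope ring_scope.

(** * Degrees in induced subgraphs *)

Section InducedSubgraphs.
Variable G : graph.
Implicit Types (u v w : G) (S X : {set G}).
Local Open Scope nat_scope.

(** In a regular graph these turn out to be the exact defensive alliances of index [- D + 2 * i]. *)
Definition connected_sets i : {set {set G}} :=
  [set S | induced_connected S && (induced_min_degree S == i)].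

Lemma deg_inDC S v : deg_in S v + deg_in (~: S) v = degree v.
Proof.
rewrite /degree /deg_in (_ : [set u in [set: G] | _] = [set u | adj v u]).
  rewrite -(cardsID S [set u | adj v u]); congr (_ + _); apply: eq_card => u;
    by rewrite !inE // andbC.
by apply/setP => u; rewrite !inE.
Qed.

Lemma deg_in_lt_card S v : v \in S -> deg_in S v < #|S|.
Proof.
move=> vS; rewrite (cardsD1 v) vS add1n ltnS; apply: subset_leq_card.
apply/subsetP => u; rewrite !inE => /andP[-> vu]; rewrite andbT.
by apply: contraTneq vu => ->; rewrite adj_irr.
Qed.

Lemma induced_min_degree_le S v : v \in S -> induced_min_degree S <= deg_in S v.
Proof. by move=> vS; apply: (@bigmin_inf _ nat _ _ v _ _ (deg_in S)). Qed.

Lemma induced_min_degree_attained S :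
  S != set0 -> exists2 v, v \in S & induced_min_degree S = deg_in S v.
Proof.
case/set0Pn => v0 v0S; case: (arg_minnP (deg_in S) v0S) => v vS vmin.
exists v => //; apply/eqP; rewrite eqn_leq induced_min_degree_le //=.
apply: (@le_bigmin _ nat) => //.
(* The default [graph_order] of the minimum exceeds the degree of [v] in [S], so it does not affect
   the value. *)
rewrite leEnat ltnW // (leq_trans (deg_in_lt_card vS)) //.
exact: max_card.
Qed.

Lemma induced_min_degree_eq S i v :
  v \in S -> deg_in S v = i -> {in S, forall u, i <= deg_in S u} ->
  induced_min_degree S = i.
Proof.
move=> vS degv mini; apply/eqP; rewrite eqn_leq -{1}degv.
rewrite induced_min_degree_le //=.
have [|u uS ->] := @induced_min_degree_attained S; last exact: mini.
by apply/set0Pn; exists v.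
Qed.

(** * Connectivity and components *)

Lemma induced_connectedP S :
  reflect (S != set0 /\ {in S &, forall x y, connect (induced S) x y})
          (induced_connected S).
Proof.
apply: (iffP andP) => -[S0 Sc]; split=> //.
  by move=> x y xS yS; have /forall_inP/(_ _ xS)/forall_inP/(_ _ yS) := Sc.
by apply/forall_inP => x xS; apply/forall_inP => y yS; apply: Sc.
Qed.

Lemma inducedE X x y : induced X x y = [&& x \in X, y \in X & adj x y].
Proof. by []. Qed.

Lemma induced_sym X : symmetric (induced X).
Proof. by move=> x y; rewrite !inducedE adj_sym andbCA. Qed.

Lemma connect_induced_sym X : connect_sym (induced X).
Proof. exact/sym_connect_sym/induced_sym. Qed.

Lemma connect_induced_closed X u w :
  {in X, forall x y, y \notin X -> ~~ adj x y} ->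
  u \in X -> connect (induced [set: G]) u w -> w \in X.
Proof.
move=> Xcl uX /connectP[s];
elim: s u uX => [|y s IHs] u uX /=; first by move=> _ ->.
move=> /andP[uy ys]; apply: IHs => //.
move: uy; rewrite inducedE !inE /=; apply: contraTT; exact: Xcl.
Qed.

(** For [u] outside [X] this is the singleton of [u], whence the hypothesis [u \in X] in several
    lemmas below. *)
Definition component X u : {set G} := [set w | connect (induced X) u w].

Lemma component_refl X u : u \in component X u.
Proof. by rewrite inE connect0. Qed.

Lemma component_eq X u w : w \in component X u -> component X w = component X u.
Proof.
rewrite inE => uw; apply/setP => x; rewrite !inE.
by rewrite (same_connect (@connect_induced_sym X) uw).
Qed.

Lemma component_sub X u : u \in X -> component X u \subset X.
Proof.
move=> uX; apply/subsetP => w; rewrite inE => /connectP[s].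
elim: s u uX => [|y s IHs] u uX /=; first by move=> _ ->.
by move=> /andP[/and3P[_ yX _] ys]; apply: IHs.
Qed.

Lemma component_adj X u x y :
  u \in X -> x \in component X u -> y \in X -> adj x y -> y \in component X u.
Proof.
move=> uX xC yX xy; have xX := subsetP (component_sub uX) _ xC.
move: xC; rewrite !inE => /connect_trans-> //.
by apply: connect1; rewrite inducedE xX yX.
Qed.

(** A walk in [X] that starts in the component never leaves it, so its edges are edges of the
    subgraph induced on the component. *)
Lemma component_connected X u : u \in X -> induced_connected (component X u).
Proof.
move=> uX; apply/induced_connectedP; split.
  by apply/set0Pn; exists u; apply: component_refl.
move=> x y xC; rewrite -(component_eq xC) inE => /connectP[s].
elim: s x xC => [|z s IHs] x xC /= ; first by move=> _ ->; rewrite connect0.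
move=> /andP[xz zs] ylast; have /and3P[xX zX adj_xz] := xz.
have zC := component_adj uX xC zX adj_xz.
(* The set is written as the component of the current start of the walk; this equality moves the
   induction hypothesis from [z] back to [x]. *)
have zx : component X z = component X x.
  by rewrite (component_eq zC) (component_eq xC).
rewrite -zx; apply: connect_trans (IHs z zC zs ylast).
by apply: connect1; rewrite inducedE zx (component_eq xC) xC zC.
Qed.

(** Connectedness puts [S] inside the component of [u]; since no edge leaves [S], the component
    cannot be larger. *)
Lemma connected_closed_component S u :
  induced_connected S -> {in S, forall x y, y \notin S -> ~~ adj x y} ->
  u \in S -> S = component [set: G] u.
Proof.
move=> /induced_connectedP[_ Sc] Scl uS; apply/setP => w; rewrite inE.
apply/idP/idP => [wS | ]; last exact: connect_induced_closed.
apply: connect_sub (Sc _ _ uS wS) => x y /and3P[_ _ xy].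
by apply: connect1; rewrite inducedE !inE.
Qed.

Lemma connected_graph_card_components :
  connected_graph G <-> #|[set component [set: G] u | u : G]| = 1.
Proof.
have [u0 _] : exists u : G, u \in [set: G].
  by apply/set0Pn; rewrite -card_gt0 cardsT vertex_gt0.
split=> [/induced_connectedP[_ Gc] | /eqP/cards1P[C defC]].
  apply/eqP/cards1P; exists (component [set: G] u0).
  apply/setP => C; rewrite inE; apply/imsetP/eqP => [[u _ ->]|->]; last by exists u0.
  by apply: component_eq; rewrite inE Gc // inE.
apply/induced_connectedP; split=> [|x y _ _]; first by apply/set0Pn; exists u0.
have comp1 z : component [set: G] z = C.
  by apply/set1P; rewrite -defC; apply/imsetP; exists z.
have : y \in component [set: G] x by rewrite comp1 -(comp1 y) component_refl.
by rewrite inE.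
Qed.

(** * Connected sets of minimum degree 0 and 1, and the degree sum *)

Lemma connected_set1 v : induced_connected [set v].
Proof.
apply/induced_connectedP; split; first by apply/set0Pn; exists v; rewrite inE.
by move=> x y /set1P-> /set1P->; rewrite connect0.
Qed.

Lemma deg_in_set1 v : deg_in [set v] v = 0.
Proof. by have := deg_in_lt_card (set11 v); rewrite cards1 ltnS leqn0 => /eqP. Qed.

(** A connected set with an isolated vertex is a singleton: a walk from that vertex to another one
    would begin with an edge inside the set. *)
Lemma card_connected_sets0 : #|connected_sets 0| = graph_order G.
Proof.
rewrite /graph_order -cardsT -(card_imset _ (@set1_inj G)); congr #|pred_of_set _|.
apply/setP => S; rewrite inE.
apply/andP/imsetP => [[/induced_connectedP[S0 Sc] /eqP S_deg0]|[v _ ->]].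
  have [v vS] := induced_min_degree_attained S0; rewrite S_deg0 => degv.
  exists v => //; apply/setP => w; rewrite inE; apply/idP/eqP => [wS|-> //].
  have /connectP[[|y s] /= vs ->//] := Sc v w vS wS.
  have /andP[/and3P[_ yS vy] _] := vs.
  by have /eqP := esym degv; rewrite cards_eq0 => /eqP/setP/(_ y); rewrite !inE yS vy.
split; first exact: connected_set1.
by apply/eqP/(@induced_min_degree_eq _ _ v); rewrite ?inE ?deg_in_set1.
Qed.

(** Each end of an edge has the other end as its only neighbour within the edge. This gives the
    bound by the size in (v). *)
Lemma edges_sub_connected_sets1 : edges G \subset connected_sets 1.
Proof.
apply/subsetP => _ /imsetP[[x y] /= xy ->]; rewrite inE; apply/andP.
rewrite inE /= in xy; have yx : adj y x by rewrite adj_sym.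
have xNy : x != y by apply: contraTneq xy => ->; rewrite adj_irr.
split.
  apply/induced_connectedP; split; first by apply/set0Pn; exists x; rewrite !inE eqxx.
  move=> u w; rewrite !inE => /orP[]/eqP-> /orP[]/eqP->; rewrite ?connect0 //;
    by apply: connect1; rewrite inducedE !inE !eqxx ?orbT.
apply/eqP/(@induced_min_degree_eq _ _ x); first by rewrite !inE eqxx.
  apply/eqP; rewrite eqn_leq; apply/andP; split.
    have /deg_in_lt_card : x \in [set x; y] by rewrite !inE eqxx.
    by rewrite cards2 xNy ltnS.
  by rewrite card_gt0; apply/set0Pn; exists y; rewrite !inE eqxx orbT.
move=> u; rewrite !inE => /orP[]/eqP->; rewrite card_gt0; apply/set0Pn;
  [exists y | exists x]; by rewrite !inE eqxx ?orbT.
Qed.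

(** Ordered adjacent pairs are counted in two ways: by first entry, and by underlying edge. *)
Lemma handshake : \sum_(v : G) degree v = 2 * graph_size G.
Proof.
transitivity #|[set e : G * G | adj e.1 e.2]|.
  rewrite -sum1dep_card -(pair_big_dep xpredT _ (fun _ _ => 1)) /=.
  apply: eq_bigr => v _.
  by rewrite sum1dep_card; apply: eq_card => u; rewrite !inE.
rewrite -sum1dep_card.
rewrite (partition_big (fun e : G * G => [set e.1; e.2]) (mem (edges G))) /=;
  last first.
  by move=> e He; apply/imsetP; exists e; rewrite // inE.
rewrite mulnC -sum_nat_const; apply: eq_bigr => _ /imsetP[[x y] /= xy ->].
rewrite inE /= in xy; have yx : adj y x by rewrite adj_sym.
have xNy : x != y by apply: contraTneq xy => ->; rewrite adj_irr.
(* The fibre over an edge consists of its two orientations, which differ because there are no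
   loops. *)
rewrite sum1dep_card (_ : [set _ | _] = [set (x, y); (y, x)]).
  by rewrite cards2 xpair_eqE negb_and xNy.
apply/setP => -[u w]; rewrite !inE /= !xpair_eqE.
apply/andP/orP => [[uw /eqP/setP E] | [] /andP[/eqP-> /eqP->]]; last 2 first.
- by rewrite xy eqxx.
- by rewrite yx setUC eqxx.
have xyE z : z \in [set u; w] -> z = x \/ z = y.
  by rewrite E !inE => /orP[]/eqP; [left | right].
have [uE|uE] : u = x \/ u = y by apply: xyE; rewrite !inE eqxx.
  have [wE|wE] : w = x \/ w = y by apply: xyE; rewrite !inE eqxx orbT.
    by rewrite uE wE adj_irr in uw.
  by left; rewrite uE wE !eqxx.
have [wE|wE] : w = x \/ w = y by apply: xyE; rewrite !inE eqxx orbT.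
  by right; rewrite uE wE !eqxx.
by rewrite uE wE adj_irr in uw.
Qed.

End InducedSubgraphs.

(** * Cut vertices and the components left after deleting a vertex *)

Section CutVertices.
Variable G : graph.
Implicit Types (u v w : G) (S : {set G}).
Local Open Scope nat_scope.

Definition neighbours v : {set G} := [set u | adj v u].

(** Only the components of G - v that contain a neighbour of [v] are kept; G itself may be
    disconnected. *)
Definition near_components v : {set {set G}} :=
  [set component (~: [set v]) u | u in neighbours v].

Definition boundary S : {set G} :=
  [set w | (w \notin S) && [exists x in S, adj x w]].

Lemma card_neighbours v : #|neighbours v| = degree v.
Proof. by apply: eq_card => u; rewrite !inE. Qed.

Lemma neighbour_neq u v : u \in neighbours v -> u \in ~: [set v].
Proof. by rewrite !inE; apply: contraTneq => ->; rewrite adj_irr. Qed.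

(* Redirecting v to one of its neighbours maps every walk of G to a walk of
   G - v, so components of G - v meeting the same component of G coincide. *)
Lemma cut_vertex_neighbours v :
  cut_vertex v ->
  exists u w, [/\ adj v u, adj v w & ~~ connect (induced (~: [set v])) u w].
Proof.
set e := induced _; move=> v_cut.
suff /existsP[u /existsP[w /and3P[? ? ?]]] :
  [exists u, exists w, [&& adj v u, adj v w & ~~ connect e u w]] by exists u, w.
apply: contraLR v_cut => /existsPn no_cut.
have near_conn u w : adj v u -> adj v w -> connect e u w.
  by move=> vu vw; have /existsPn/(_ w) := no_cut u; rewrite vu vw negbK.
(* If [v] is isolated then [u0] is [v] and [f] is the identity, which is harmless as no edge meets
   [v]. *)
pose u0 := odflt v [pick u | adj v u]; pose f x := if x == v then u0 else x.
have u0_adj u : adj v u -> adj v u0.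
  by rewrite /u0; case: pickP => // none; rewrite none.
have f_edge x y : adj x y -> connect e (f x) (f y).
  rewrite /f; case: eqVneq => [->|xv]; case: eqVneq => [->|yv]; rewrite ?connect0 //.
  - by move=> vy; exact: near_conn (u0_adj _ vy) vy.
  - by rewrite adj_sym => vx; exact: near_conn vx (u0_adj _ vx).
  by move=> xy; apply: connect1; rewrite /e inducedE !inE xv yv.
have f_conn x y : connect (induced [set: G]) x y -> connect e (f x) (f y).
  case/connectP => s; elim: s x => [|z s IHs] x /=; first by move=> _ ->.
  move=> /andP[/and3P[_ _ xz] zs] ylast.
  exact: connect_trans (f_edge _ _ xz) (IHs z zs ylast).
have eS := @connect_induced_sym G (~: [set v]).
have GS := @connect_induced_sym G [set: G].
rewrite -leqNgt /num_components /n_comp_mem.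
(* Each component of G - v is sent to the component of G containing it. Under [no_cut] this map is
   injective, so deleting [v] does not increase the number of components. *)
have root_inj : {in predI (roots e) (mem (~: [set v])) &,
    injective (fingraph.root (induced [set: G]))}.
  move=> x y; rewrite !inE => /andP[/eqP rx xv] /andP[/eqP ry yv] /eqP.
  rewrite root_connect // => /f_conn; rewrite /f (negPf xv) (negPf yv) => xy.
  by rewrite -rx -ry; apply/eqP; rewrite root_connect.
rewrite -(card_in_image root_inj).
apply/subset_leq_card/subsetP => _ /imageP[x _ ->].
by rewrite inE /= roots_root ?inE.
Qed.

(** An edge leaving a component of G - v can only end at [v], and the chosen neighbour of [v]
    provides such an edge. *)
Lemma near_components_boundary v S :
  S \in near_components v -> boundary S = [set v].
Proof.
case/imsetP => u vu ->{S}; have uv := neighbour_neq vu.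
have Csub := subsetP (component_sub uv).
apply/setP => w; rewrite !inE; apply/andP/eqP => [[wNC /exists_inP[x xC xw]]|->].
  apply: contraNeq wNC => wv; have := component_adj uv xC _ xw.
  by rewrite !inE; apply.
split; last first.
  by apply/exists_inP; exists u; rewrite ?component_refl // adj_sym -in_set.
by apply/negP => uv'; have := Csub v; rewrite !inE eqxx => /(_ uv').
Qed.

Lemma card_near_components v :
  0 < degree v -> 1 + cut_vertex v <= #|near_components v|.
Proof.
rewrite -card_neighbours card_gt0 => /set0Pn[u0 vu0].
case: (boolP (cut_vertex v)) => [/cut_vertex_neighbours[u [w [vu vw uNw]]]|_] /=.
  suff CuCw : component (~: [set v]) u != component (~: [set v]) w.
    rewrite -[1 + true]/(true.+1) -CuCw -cards2.
    by apply/subset_leq_card/subsetP => C /set2P[]->; apply: imset_f; rewrite inE.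
  apply: contraNneq uNw => CuCw.
  by have := component_refl (~: [set v]) w; rewrite -CuCw inE.
by rewrite card_gt0; apply/set0Pn; eexists; apply: imset_f vu0.
Qed.

End CutVertices.

(** * Exact indices in regular graphs *)

Section RegularGraphs.
Variables (G : graph) (D : nat).
Hypothesis G_regular : is_regular G D.
Implicit Types (u v : G) (S : {set G}).

Lemma regular_max_degree : max_degree G = D.
Proof.
have /card_gt0P[v0 _] := vertex_gt0 G.
rewrite /max_degree (eq_bigr (fun=> D)) => [|v _]; last exact: G_regular.
apply/eqP; rewrite eqn_leq; apply/andP; split; first by apply/bigmax_leqP.
by rewrite (bigD1 v0) //= leq_maxl.
Qed.

Lemma regular_lt_order : (D < graph_order G)%N.
Proof.
have /card_gt0P[v0 _] := vertex_gt0 G.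
by rewrite -(G_regular v0) /graph_order -cardsT deg_in_lt_card ?inE.
Qed.

Lemma regular_size : (2 * graph_size G = graph_order G * D)%N.
Proof.
by rewrite -handshake (eq_bigr (fun=> D)) ?sum_nat_const.
Qed.

Lemma deg_in_le S v : (deg_in S v <= D)%N.
Proof. by rewrite -(G_regular v) -(deg_inDC S v) leq_addr. Qed.

Lemma induced_min_degree_le_regular S :
  induced_connected S -> (induced_min_degree S <= D)%N.
Proof.
case/induced_connectedP => S0 _.
by have [v _ ->] := induced_min_degree_attained S0; apply: deg_in_le.
Qed.

Lemma mem_alliance_range (k : int) :
  (k \in alliance_range G) = (- D%:Z <= k <= D%:Z).
Proof.
rewrite /alliance_range regular_max_degree.
apply/mapP/idP => [[j]|kD]; first by rewrite mem_iota => ? ->; lia.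
by exists (absz (k + D%:Z)); [rewrite mem_iota; lia | lia].
Qed.

Lemma exact_index_regular S :
  induced_connected S ->
  exact_index S = - D%:Z + (2 * induced_min_degree S)%:Z.
Proof.
move=> Sc; have mdD := induced_min_degree_le_regular Sc.
have /induced_connectedP[S0 _] := Sc.
apply/eqP; rewrite eq_le /exact_index regular_max_degree; apply/andP; split.
  apply: bigmax_le => [|k /and3P[_ _ /forall_inP Sk]]; first lia.
  (* A vertex of least degree in [S] bounds every admissible [k] from above. *)
  have [v vS mdv] := induced_min_degree_attained S0.
  have := Sk v vS; have := deg_inDC S v; rewrite G_regular; lia.
(* Conversely the claimed value lies in the range and is admissible at every vertex of [S]. *)
apply: (@le_bigmax_seq _ int int _ _ _ _ (fun k => k));
  first by rewrite mem_alliance_range; lia.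
rewrite /defensive_alliance regular_max_degree Sc /=; apply/andP; split; first lia.
apply/forall_inP => v vS; have := induced_min_degree_le vS.
have := deg_inDC S v; rewrite G_regular; lia.
Qed.

Lemma num_exact_alliances_regular (i : nat) :
  num_exact_alliances G (- D%:Z + (2 * i)%:Z) = #|connected_sets G i|.
Proof.
apply: eq_card => S; rewrite !inE /exact_alliance.
apply: andb_id2l => Sc; rewrite exact_index_regular //.
by rewrite (inj_eq (addrI _)) eqz_nat eqn_pmul2l.
Qed.

(** * Connected sets of minimum degree [D] and [D.-1] *)

Lemma connected_sets_max_degree :
  connected_sets G D = [set component [set: G] u | u : G].
Proof.
apply/setP => S; rewrite inE; apply/andP/imsetP => [[Sc /eqP mdS]|[u _ ->]].
  have /induced_connectedP[/set0Pn[u uS] _] := Sc; exists u => //.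
  apply: connected_closed_component => // x xS y yNS.
  (* Having [D] neighbours inside [S] leaves none for the complement, so no edge leaves [S]. *)
  have := induced_min_degree_le xS.
  rewrite mdS -{1}(G_regular x) -(deg_inDC S x).
  rewrite -leq_subRL // subnn leqn0 cards_eq0 => /eqP/setP/(_ y).
  by rewrite !inE yNS => /= ->.
have uT : u \in [set: G] by rewrite inE.
split; first exact: component_connected.
have degC x : x \in component [set: G] u -> deg_in (component [set: G] u) x = D.
  move=> xC; rewrite -(G_regular x); apply: eq_card => y; rewrite !inE.
  apply: andb_idl => xy; have := component_adj uT xC _ xy.
  by rewrite !inE; apply.
apply/eqP/(@induced_min_degree_eq _ _ _ u);
  rewrite ?degC ?component_refl //.
by move=> x /degC->.
Qed.

(** The components are disjoint, and each has a vertex with [D] neighbours inside it, hence more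
    than [D] vertices. *)
Lemma card_connected_sets_max_degree :
  (#|connected_sets G D| * D.+1 <= graph_order G)%N.
Proof.
rewrite connected_sets_max_degree; set P := imset _ _.
have trivP : trivIset P.
  apply/trivIsetP => _ _ /imsetP[x _ ->] /imsetP[y _ ->]; apply: contraR.
  by case/pred0Pn => z /andP[/component_eq<- /component_eq<-].
rewrite -sum_nat_const; apply: leq_trans (max_card (cover P)).
rewrite -(eqP trivP); apply: leq_sum => S.
rewrite /P -connected_sets_max_degree inE => /andP[/induced_connectedP[S0 _] /eqP<-].
by have [v vS ->] := induced_min_degree_attained S0; apply: deg_in_lt_card.
Qed.

(** A vertex of [S] can have no outside neighbour but [v], so its degree in [S] is at least [D.-1],
    with equality at a neighbour of [v]. *)
Lemma near_components_connected v S :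
  S \in near_components v -> S \in connected_sets G D.-1.
Proof.
move=> vS; have bdS := near_components_boundary vS.
have /imsetP[u vu defS] := vS; have uS : u \in S by rewrite defS component_refl.
have outside x : x \in S -> [set y in ~: S | adj x y] \subset [set v].
  move=> xS; apply/subsetP => y; rewrite -bdS !inE => /andP[->] xy.
  by apply/exists_inP; exists x.
rewrite inE; apply/andP; split.
  by rewrite defS component_connected // neighbour_neq.
have vNS : v \notin S.
  by have : v \in boundary S by [rewrite bdS inE]; rewrite inE => /andP[].
apply/eqP/(@induced_min_degree_eq _ _ _ u) => // [|x xS].
  have := deg_inDC S u; rewrite G_regular => <-.
  suff -> : deg_in (~: S) u = 1%N by rewrite addn1.
  apply/eqP; rewrite eqn_leq -{1}(cards1 v) subset_leq_card ?outside //=.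
  rewrite card_gt0; apply/set0Pn; exists v; move: vu.
  by rewrite !inE vNS adj_sym.
have := subset_leq_card (outside x xS); rewrite cards1.
have := deg_inDC S x; rewrite G_regular /deg_in; lia.
Qed.

(* The boundary of a component of G - v near v is {v}, so distinct vertices
   yield disjoint families of components. *)
Lemma card_connected_sets_pred_degree :
  (0 < D)%N ->
  (graph_order G + #|[set v : G | cut_vertex v]| <= #|connected_sets G D.-1|)%N.
Proof.
move=> D0.
have -> : (graph_order G + #|[set v : G | cut_vertex v]|
           = \sum_(v : G) (1 + cut_vertex v))%N.
  rewrite big_split /= sum_nat_const muln1 -sum1dep_card big_mkcond.
  by congr (_ + _)%N; apply: eq_bigr => v _; case: ifP.
(* Double counting of the pairs [(v, S)] with [boundary S] equal to [[set v]]: the left side bounds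
   the number of [S] for each [v], and each [S] occurs with at most one [v]. *)
apply: (@leq_trans (\sum_(v : G) \sum_(S in connected_sets G D.-1)
                      (boundary S == [set v]))%N).
  apply: leq_sum => v _.
  apply: leq_trans (card_near_components _) _; first by rewrite G_regular.
  rewrite -sum1_card big_mkcond [leqRHS]big_mkcond; apply: leq_sum => S _.
  case: ifP => // vS; rewrite (near_components_connected vS).
  by rewrite (near_components_boundary vS) eqxx.
rewrite exchange_big /= -sum1_card; apply: leq_sum => S _.
rewrite -big_mkcond /= sum1dep_card; apply/card_le1_eqP => u v.
by rewrite !inE => /eqP-> /eqP/set1_inj.
Qed.

(** * Factorisation of the alliance polynomial *)

Section AlliancePoly.
Variable R : nzRingType.

Definition degree_poly : {poly R} :=
  \sum_(S : {set G} | induced_connected S) 'X^(induced_min_degree S).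

Lemma coef_degree_poly i : degree_poly`_i = #|connected_sets G i|%:R.
Proof.
rewrite coef_sum -sum1dep_card natr_sum [RHS]big_mkcondr; apply: eq_bigr => S _.
by rewrite coefXn eq_sym; case: eqP.
Qed.

End AlliancePoly.

(** After exchanging the sums, each connected [S] contributes one monomial, of exponent n - D + 2
    d(S), where d(S) is its induced minimum degree. *)
Lemma alliance_poly_regular (R : comNzRingType) :
  alliance_poly G R = 'X^(graph_order G - D) * (degree_poly R \Po 'X^2).
Proof.
rewrite /degree_poly raddf_sum mulr_sumr /=.
transitivity
  (\sum_(k <- alliance_range G) \sum_(S : {set G} | induced_connected S)
     (if exact_index S == k then 'X^(absz ((graph_order G)%:Z + k))
      else 0 : {poly R})).
  apply: eq_bigr => k _; rewrite /num_exact_alliances -sum1dep_card natr_sum.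
  rewrite scaler_suml.
  by rewrite -big_mkcondr; apply: eq_bigr => S _; rewrite scale1r.
rewrite exchange_big; apply: eq_bigr => S Sc /=.
have mdD := induced_min_degree_le_regular Sc; have Dn := regular_lt_order.
(* Exactly one [k] of the range matches the exact index of [S]: it occurs there, and only once. *)
have range_uniq : uniq (alliance_range G).
  by rewrite map_inj_uniq ?iota_uniq // => j k; lia.
have in_range : exact_index S \in alliance_range G.
  by rewrite mem_alliance_range exact_index_regular //; lia.
rewrite (bigD1_seq (exact_index S)) //= -/(alliance_range G).
rewrite eqxx big1 => [|k]; last by rewrite eq_sym => /negPf->.
rewrite addr0 comp_Xn_poly -exprM -exprD exact_index_regular //.
congr ('X^_); lia.
Qed.

End RegularGraphs.

(** * The seven properties *)

Theorem theorem2p3 (R : realType) (G : graph) (Delta n m : nat)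
    (G_regular : is_regular G Delta)
    (G_order : graph_order G = n) (G_size : graph_size G = m) :
  let A := num_exact_alliances G in
  let p := alliance_poly G R in
  (forall i : nat, (i <= Delta)%N ->
     A (- Delta%:Z + (2 * i)%:Z) =
     #|[set S : {set G} | induced_connected S && (induced_min_degree S == i)]|)
  /\ (Deg_min p = (n - Delta)%N /\ A (- Delta%:Z) = n)
  /\ (Deg p = (n + Delta)%N
      /\ n%:R = ((Deg_min p)%:R + (Deg p)%:R) / 2 :> rat
      /\ m%:R = (A (- Delta%:Z))%:R * (((Deg p)%:R - (Deg_min p)%:R) / 4) :> rat
      /\ m%:R = ((Deg p)%:R ^+ 2 - (Deg_min p)%:R ^+ 2) / 8 :> rat)
  /\ ((1 <= A Delta%:Z)%N
      /\ (A Delta%:Z)%:R <= n%:R / (Delta.+1)%:R :> rat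
      /\ (connected_graph G <-> A Delta%:Z = 1%N))
  /\ ((0 < Delta)%N ->
        (m <= A (- Delta%:Z + 2)%R)%N
        /\ (n + #|[set v : G | cut_vertex v]| <= A (Delta%:Z - 2)%R)%N
        /\ (n <= A (Delta%:Z - 2)%R)%N)
  /\ ((even_function (horner p) \/ odd_function (horner p))
      /\ (even_function (horner p) <-> ~~ odd (n + Delta)))
  /\ ((forall x : R, root p x <-> x = 0) /\ mup 0 p = (n - Delta)%N).
Proof.
move=> A p.
have Dn : (Delta < n)%N by rewrite -G_order regular_lt_order.
have A_sets i : A (- Delta%:Z + (2 * i)%:Z) = #|connected_sets G i|.
  exact: num_exact_alliances_regular.
have A_min : A (- Delta%:Z) = n.
  by rewrite -G_order -card_connected_sets0 -A_sets muln0 addr0.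
have A_max : A Delta%:Z = #|connected_sets G Delta|.
  by rewrite -A_sets; congr A; lia.
have card_max_gt0 : (0 < #|connected_sets G Delta|)%N.
  have /card_gt0P[v _] := vertex_gt0 G.
  rewrite (connected_sets_max_degree G_regular) card_gt0; apply/set0Pn.
  by exists (component [set: G] v); apply: imset_f.
pose q := degree_poly G R.
have pE : p = 'X^(n - Delta) * (q \Po 'X^2).
  by rewrite /p (alliance_poly_regular G_regular) G_order.
have p_horner x : p.[x] = x ^+ (n - Delta) * q.[x ^+ 2].
  by rewrite pE hornerM horner_comp !hornerXn.
(* A singleton contributes the constant 1, and every other term is nonnegative for [x] at least
   0. *)
have q_gt0 (x : R) : 0 <= x -> 0 < q.[x].
  move=> x0; have /card_gt0P[v _] := vertex_gt0 G.
  have mdv : induced_min_degree [set v] = 0%N.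
    by apply/(@induced_min_degree_eq _ _ _ v); rewrite ?inE ?deg_in_set1.
  rewrite horner_sum (bigD1 [set v]) ?connected_set1 //= mdv hornerXn expr0.
  by rewrite ltr_pwDl // sumr_ge0 // => S _; rewrite hornerXn exprn_ge0.
have size_q : size q = Delta.+1.
  apply/eqP; rewrite eqn_leq; apply/andP; split.
    apply/leq_sizeP => i Di; rewrite coef_degree_poly.
    rewrite (_ : connected_sets G i = set0) ?cards0 //.
    apply/setP => S; rewrite !inE; apply/negP => /andP[Sc /eqP mdS].
    have := induced_min_degree_le_regular G_regular Sc.
    by rewrite mdS leqNgt Di.
  rewrite ltnNge; apply/negP => /leq_sizeP/(_ _ (leqnn _))/eqP.
  by rewrite coef_degree_poly pnatr_eq0 eqn0Ngt card_max_gt0.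
have qX_neq0 : q \Po 'X^2 != 0.
  apply: contraTneq (q_gt0 (0 ^+ 2) (sqr_ge0 _)) => /(congr1 (horner ^~ 0)).
  by rewrite horner_comp hornerXn horner0 => ->; rewrite ltxx.
have size_p : size p = (n + Delta).+1.
  have size_qX : size (q \Po 'X^2) = (Delta * 2).+1.
    by rewrite -[LHS]prednK ?size_poly_gt0 // size_comp_poly size_q size_polyXn.
  by rewrite pE size_monicM ?monicXn // size_polyXn size_qX; lia.
have degp : Deg p = (n + Delta)%N by rewrite /Deg size_p.
have degminp : Deg_min p = (n - Delta)%N.
  have p_coef i : (i < n - Delta)%N -> p`_i = 0.
    by move=> lti; rewrite pE coefXnM lti.
  (* This coefficient is the value of [q] at 0. *)
  have p_coefmin : p`_(n - Delta) != 0.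
    rewrite pE coefXnM ltnn subnn -horner_coef0 horner_comp hornerXn.
    by rewrite gt_eqF // q_gt0 // sqr_ge0.
  have lt_size : (n - Delta < size p)%N by rewrite size_p; lia.
  apply/eqP; rewrite eqn_leq; apply/andP; split.
    exact: (@bigmin_inf _ nat _ _ (Ordinal lt_size) _ _ (@nat_of_ord _)).
  (* The default [size p] of the minimum also lies above n - Delta. *)
  apply: (@le_bigmin _ nat); first by rewrite leEnat ltnW.
  by move=> i; apply: contraR; rewrite leEnat -ltnNge => /p_coef->.
have size_eq : (2 * m = n * Delta)%N.
  by rewrite -G_size -G_order (regular_size G_regular).
have m_half : m%:R = n%:R * Delta%:R / 2 :> rat.
  by rewrite -natrM -size_eq natrM mulrC mulKf.
have root_p x : root p x <-> x = 0.
  rewrite rootE p_horner mulf_eq0 expf_eq0 subn_gt0 Dn /= orbC.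
  rewrite gt_eqF ?q_gt0 ?sqr_ge0 //=.
  by split => [/eqP|->].
(* The sign is that of the factor of exponent n - Delta, which has the parity of n + Delta. *)
have p_opp x : p.[- x] = (-1) ^+ (n + Delta) * p.[x].
  rewrite !p_horner sqrrN [(- x) ^+ _]exprNn mulrA; congr (_ * _ * _).
  by rewrite -signr_odd -[RHS]signr_odd oddB ?oddD // ltnW.
split=> [i _|]; first by rewrite A_sets.
do 2![split=> //].
  split=> //; rewrite degp degminp A_min natrD natrB ?(ltnW Dn) //.
  by rewrite m_half; split; [|split]; field.
split.
  rewrite A_max; split=> //; split.
    rewrite ler_pdivlMr ?ltr0n // -natrM ler_nat -G_order.
    exact: card_connected_sets_max_degree.
  rewrite (connected_sets_max_degree G_regular).
  exact: connected_graph_card_components.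
split=> [D0|].
  have A_pred : A (Delta%:Z - 2) = #|connected_sets G Delta.-1|.
    by rewrite -A_sets; congr A; lia.
  have cut_le : (n + #|[set v : G | cut_vertex v]| <= A (Delta%:Z - 2)%R)%N.
    by rewrite A_pred -G_order card_connected_sets_pred_degree.
  split; last by split=> //; apply: leq_trans cut_le; rewrite leq_addr.
  have -> : A (- Delta%:Z + 2) = #|connected_sets G 1| by rewrite -A_sets.
  by rewrite -G_size subset_leq_card ?edges_sub_connected_sets1.
split; last first.
  (* The factor in x^2 does not vanish at 0, so the multiplicity comes from the power of x alone. *)
  split=> //; rewrite pE mupMl.
    by rewrite -['X]subr0 -polyC0 mup_XsubCX eqxx.
  by rewrite rootE horner_comp hornerXn gt_eqF ?q_gt0 ?sqr_ge0.
have p1_neq0 : p.[1] != 0 by apply/negP => /root_p/eqP; rewrite oner_eq0.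
case: (boolP (odd (n + Delta))) => nD.
  split; first by right=> x; rewrite p_opp -signr_odd nD mulN1r.
  (* Evenness would give p(1) = - p(1), contradicting that 1 is not a root. *)
  split=> // /(_ 1); rewrite p_opp -signr_odd nD mulN1r => /eqP.
  by rewrite -subr_eq0 -opprD oppr_eq0 -mulr2n mulrn_eq0 (negPf p1_neq0).
have p_even : even_function (horner p).
  by move=> x; rewrite p_opp -signr_odd (negPf nD) mul1r.
by split; [left|].
Qed.
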